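(* Let $(E,B,P)$ be a probability space and let $a<b$ be real numbers. Let $f:[a,b]\to L(E,B,P)$ be Kurzweil-Henstock integrable in probability on $[a,b]$, and suppose there exists $A\in L^1(E,B,P)$ with $A(\omega)\ge 0$ for a.e. $\omega\in E$ such that $P(\{\omega\in E : |f(t,\omega)|\le A(\omega)\})=1$ for all $t\in[a,b]$. Then the function $\varphi(t)=\int_E f(t,\omega)\,dP(\omega)$, $t\in[a,b]$, is Kurzweil-Henstock integrable on $[a,b]$ and $$(KH)\int_a^b\left[\int_E f(t,\omega)\,dP(\omega)\right]dt=\int_E\left[(KH)\int_a^b f(t,\omega)\,dt\right]dP(\omega).$$
   Context: $(E,B,P)$ is a probability space ($E$ a nonempty set, $B$ a $\sigma$-field of subsets of $E$, $P$ a countably additive probability on $B$). $L(E,B,P)$ denotes the set of all real random variables defined on $E$ that are a.e. finite (pointwise expressions in such random variables are understood outside a $P$-null set), and $L^1(E,B,P)=\{g\in L(E,B,P) : \int_E|g(\omega)|\,dP(\omega)<+\infty\}$. For $f:[a,b]\to L(E,B,P)$ write $f(t,\omega)$ for the value of the random variable $f(t)$ at $\omega$. For a division $d: a=x_0<x_1<\dots<x_n=b$ with tags $\xi_i\in[x_i,x_{i+1}]$, $i=0,\dots,n-1$, put $S(f;d,\xi_i)(\omega)=\sum_{i=0}^{n-1}f(\xi_i,\omega)(x_{i+1}-x_i)$. A function $f:[a,b]\to L(E,B,P)$ is Kurzweil-Henstock integrable in probability on $[a,b]$ if there exists $I\in L(E,B,P)$ such that for all $\varepsilon>0$ and $\eta>0$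 there exists $\delta_{\varepsilon,\eta}:[a,b]\to(0,\infty)$ such that for every division $d:a=x_0<\dots<x_n=b$ and all $\xi_i\in[x_i,x_{i+1}]$ with $x_{i+1}-x_i<\delta_{\varepsilon,\eta}(\xi_i)$, $i=0,\dots,n-1$, one has $$P(\{\omega\in E : |S(f;d,\xi_i)(\omega)-I(\omega)|\ge\varepsilon\})<\eta.$$ Such an $I$ is unique up to $P$-a.e. equality and is denoted $I(\omega)=(KH)\int_a^b f(t,\omega)\,dt$. A function $\varphi:[a,b]\to\mathbb{R}$ is Kurzweil-Henstock integrable on $[a,b]$ if there exists $J\in\mathbb{R}$ such that for every $\varepsilon>0$ there exists $\delta_\varepsilon:[a,b]\to(0,\infty)$ such that for every division $d:a=x_0<\dots<x_n=b$ and all $\xi_i\in[x_i,x_{i+1}]$ with $x_{i+1}-x_i<\delta_\varepsilon(\xi_i)$, $i=0,\dots,n-1$, one has $|J-\sum_{i=0}^{n-1}\varphi(\xi_i)(x_{i+1}-x_i)|<\varepsilon$. One writes $J=(KH)\int_a^b\varphi(t)\,dt$. *)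

(* Defs.v *)
From HB Require Import structures.
From mathcomp Require Import all_boot all_order all_algebra.
From mathcomp Require Import all_classical all_reals all_analysis.
From mathcomp Require Import measurable_realfun.

Set Implicit Arguments.
Unset Strict Implicit.
Unset Printing Implicit Defensive.

Import Order.TTheory GRing.Theory Num.Theory.
Local Open Scope classical_set_scope.
Local Open Scope ring_scope.

(* A division a = x_0 < x_1 < ... < x_n = b is a sequence s = [:: x_1; ...; x_n]
   with itv_partition a b s. *)
Definition div_pt (R : realType) (a b : R) (s : seq R) (i : nat) : R :=
  nth b (a :: s) i.

(* The tags are xi 0, ..., xi (n - 1); the other values of xi, and the values of
   delta outside [a, b], are irrelevant. *)
Definition fine_tagged_division (R : realType) (a b : R) (delta : R -> R)
    (s : seq R) (xi : nat -> R) : Prop :=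
  itv_partition a b s /\
  forall i : nat, (i < size s)%N ->
    div_pt a b s i <= xi i <= div_pt a b s i.+1 /\
    div_pt a b s i.+1 - div_pt a b s i < delta (xi i).

Definition gauge_on (R : realType) (a b : R) (delta : R -> R) : Prop :=
  forall t : R, a <= t <= b -> 0 < delta t.

Definition riemann_sum (R : realType) (a b : R) (phi : R -> R)
    (s : seq R) (xi : nat -> R) : R :=
  \sum_(0 <= i < size s) phi (xi i) * (div_pt a b s i.+1 - div_pt a b s i).

Definition is_KH_integral (R : realType) (a b : R) (phi : R -> R) (J : R)
    : Prop :=
  forall eps : R, 0 < eps -> exists delta : R -> R, gauge_on a b delta /\
    forall (s : seq R) (xi : nat -> R), fine_tagged_division a b delta s xi ->
      `|J - riemann_sum a b phi s xi| < eps.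

Definition KH_integrable (R : realType) (a b : R) (phi : R -> R) : Prop :=
  exists J : R, is_KH_integral a b phi J.

(* L(E, B, P): random variables with values in the extended reals that are
   almost everywhere finite. *)
Definition ae_finite_rv d (E : measurableType d) (R : realType)
    (P : probability E R) : set (E -> \bar R) :=
  [set g : E -> \bar R | measurable_fun [set: E] g /\
    {ae P, forall w, g w \is a fin_num}].

(* Where some f (xi i) is infinite (a P-null set when these are a.e. finite),
   the sum follows the library's convention +oo - oo = -oo. *)
Definition rv_riemann_sum d (E : measurableType d) (R : realType) (a b : R)
    (f : R -> E -> \bar R) (s : seq R) (xi : nat -> R) (w : E) : \bar R :=
  (\sum_(0 <= i < size s)
     f (xi i) w * (div_pt a b s i.+1 - div_pt a b s i)%:E)%E.

Definition is_KH_integral_in_prob d (E : measurableType d) (R : realType)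
    (P : probability E R) (a b : R) (f : R -> E -> \bar R) (I : E -> \bar R)
    : Prop :=
  ae_finite_rv P I /\
  forall eps eta : R, 0 < eps -> 0 < eta ->
    exists delta : R -> R, gauge_on a b delta /\
      forall (s : seq R) (xi : nat -> R), fine_tagged_division a b delta s xi ->
        (P [set w | eps%:E <= `|rv_riemann_sum a b f s xi w - I w|] < eta%:E)%E.

Definition KH_integrable_in_prob d (E : measurableType d) (R : realType)
    (P : probability E R) (a b : R) (f : R -> E -> \bar R) : Prop :=
  exists I : E -> \bar R, is_KH_integral_in_prob P a b f I.

(* Main.v *)
(* By Cousin's lemma every gauge admits a fine division, so I is a limit in
   probability of Riemann sums S, each bounded a.e. by (b - a) A; hence
   |I| <= (b - a) A a.e. and I is integrable. For a fine division,
   |E[S] - E[I]| <= eps + 2 (b - a) E[A; |S - I| >= eps], where the event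
   has probability < eta; absolute continuity of the integral of A makes the
   last term small, and E[S] is the Riemann sum of t |-> E[f t]. *)
Require Import Defs.
From HB Require Import structures.
From mathcomp Require Import all_boot all_order all_algebra.
From mathcomp Require Import all_classical all_reals all_analysis.
From mathcomp Require Import measurable_realfun.
From mathcomp Require Import lra.

Set Implicit Arguments.
Unset Strict Implicit.
Unset Printing Implicit Defensive.

Import Order.TTheory GRing.Theory Num.Theory.
Local Open Scope classical_set_scope.
Local Open Scope ring_scope.

(* Cousin's lemma: with c the supremum of the points x such that [a, x] has a
   fine division, appending an interval tagged c to a division ending close
   to c reaches b. *)
Lemma fine_tagged_division_exists (R : realType) (a b : R) (delta : R -> R) :
  a <= b -> gauge_on a b delta ->
  exists s xi, fine_tagged_division a b delta s xi.
Proof.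
move=> ab gd.
pose C := [set x | a <= x <= b /\
  exists s xi, fine_tagged_division a x delta s xi].
(* The empty sequence divides the degenerate interval [a, a], so [C] is nonempty. *)
have Ca : C a.
  split; first by rewrite lexx ab.
  by exists [::], (fun=> a); split => //; split => //=.
have ubC : ubound C b by move=> x [/andP[]].
have supC : has_sup C by split; [exists a | exists b].
set c := sup C.
have ac : a <= c by apply: ub_le_sup Ca; exists b.
have cb : c <= b by apply: ge_sup => //; exists a.
have dc : 0 < delta c by apply: gd; rewrite ac.
have d3 : 0 < delta c / 3 by rewrite divr_gt0.
have [x [/andP[ax xb] [s [xi [[sp /eqP sl] sf]]]] cx] :=
  sup_adherent d3 supC.
rewrite -/c in cx.
have xc : x <= c by apply: ub_le_sup; [exists b | split; [rewrite ax |
  exists s, xi; split=> //; split=> //; exact/eqP]].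
have [xb'|xb'] := eqVneq x b.
  by exists s, xi; rewrite -xb'; split=> //; split => //; exact/eqP.
(* Since [c - delta c / 3 < x <= c <= y <= c + delta c / 3], the interval [x, y] contains its tag
   [c] and has length below [delta c]. *)
pose y := Num.min b (c + delta c / 3).
have xltb : x < b by rewrite lt_neqAle xb'.
have cy : c <= y by rewrite le_min cb; lra.
have xy : x < y by rewrite lt_min xltb; lra.
have yc : y <= c + delta c / 3 by rewrite ge_min lexx orbT.
have Cy : C y.
  split; first by rewrite ge_min lexx (le_trans ax (ltW xy)).
  exists (rcons s y), (fun i => if (i < size s)%N then xi i else c).
  split; first by split; rewrite ?last_rcons// rcons_path sp sl.
  move=> i; rewrite size_rcons ltnS leq_eqVlt => /orP[/eqP ->|is_]; last first.
    rewrite is_ /div_pt -rcons_cons !nth_rcons /= !ltnS is_ (ltnW is_).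
    have := sf i is_; rewrite /div_pt.
    (* The default of [nth] is the right endpoint, which changes from [x] to [y]; the indices are in
       range, so it is never read. *)
    by rewrite /= !(set_nth_default x y) //= ltnS ltnW.
  rewrite ltnn /div_pt -rcons_cons !nth_rcons /= ltnS leqnn ltnn eqxx.
  rewrite (_ : nth y (a :: s) (size s) = x) ?xc ?cy; first by split=> //; lra.
  by rewrite -[RHS]sl (last_nth y).
(* As [c + delta c / 3] exceeds [c], this bound forces the minimum [y] to be [b]. *)
have yc' : y <= c by apply: ub_le_sup => //; exists b.
have yb : y = b.
  by move: yc'; rewrite {1}/y ge_min => /orP[bc|]; [apply: min_l; lra | lra].
by case: Cy => _; rewrite yb.
Qed.

(** * Fine divisions and uniqueness of the integral *)

Section fine_tagged_division.
Context (R : realType) (a b : R).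
Implicit Types (delta : R -> R) (s : seq R) (xi : nat -> R).

Lemma div_pt_le s i : itv_partition a b s -> (i < size s)%N ->
  div_pt a b s i <= div_pt a b s i.+1.
Proof. by move=> [/(pathP b) sp _] /sp /ltW. Qed.

Lemma sum_div_pt s : itv_partition a b s ->
  \sum_(0 <= i < size s) (div_pt a b s i.+1 - div_pt a b s i) = b - a.
Proof.
move=> sp; rewrite (telescope_sumr (div_pt a b s))//.
by rewrite {1}/div_pt (itv_partition_nth_size _ sp).
Qed.

Lemma fine_tag_itv delta s xi i : fine_tagged_division a b delta s xi ->
  (i < size s)%N -> a <= xi i <= b.
Proof.
move=> [sp sf] is_; have [/andP[l u] _] := sf i is_.
have i1 : (i < (size s).+1)%N by rewrite ltnS ltnW.
rewrite (le_trans _ l) ?(itv_partition_nth_ge i1 sp)//=.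
by rewrite (le_trans u)// (itv_partition_nth_le _ sp).
Qed.

Lemma fine_tagged_division_le delta delta' s xi :
  (forall t, a <= t <= b -> delta t <= delta' t) ->
  fine_tagged_division a b delta s xi -> fine_tagged_division a b delta' s xi.
Proof.
move=> dd' h; split; [exact: h.1|move=> i is_].
have [? lt] := h.2 i is_; split=> //.
by apply: (lt_le_trans lt); exact/dd'/(fine_tag_itv h).
Qed.

(** Cousin's lemma provides a division fine for the minimum of the two gauges; its Riemann sum is
    within [e / 2] of both values. *)
Lemma is_KH_integral_unique phi (J J' : R) : a <= b ->
  is_KH_integral a b phi J -> is_KH_integral a b phi J' -> J = J'.
Proof.
move=> ab hJ hJ'; apply/eqP; rewrite -subr_eq0 -normr_le0.
apply/ler_addgt0Pl => e e0.
have e2 : 0 < e / 2 by rewrite divr_gt0.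
have [d1 [g1 h1]] := hJ _ e2; have [d2 [g2 h2]] := hJ' _ e2.
have g t : a <= t <= b -> 0 < Num.min (d1 t) (d2 t).
  by move=> tab; rewrite lt_min g1 ?g2.
have [s [xi h]] := fine_tagged_division_exists ab g.
have /h1 {}h1 : fine_tagged_division a b d1 s xi.
  by apply: fine_tagged_division_le h => t _; rewrite ge_min lexx.
have /h2 {}h2 : fine_tagged_division a b d2 s xi.
  by apply: fine_tagged_division_le h => t _; rewrite ge_min lexx orbT.
rewrite addr0 (le_trans (ler_distD (riemann_sum a b phi s xi) _ _))//.
by rewrite [X in _ + X]distrC; lra.
Qed.

End fine_tagged_division.

(** * Domination and limits in probability *)

Section domination.
Context d (E : measurableType d) (R : realType).
Local Open Scope ereal_scope.

Lemma ae_le_integrable (mu : {measure set E -> \bar R}) (f g : E -> \bar R) :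
  measurable_fun [set: E] f -> {ae mu, forall w, `|f w| <= `|g w|} ->
  mu.-integrable [set: E] g -> mu.-integrable [set: E] f.
Proof.
move=> mf fg /integrableP[mg goo]; apply/integrableP; split => //.
apply: le_lt_trans goo; apply: ae_ge0_le_integral => //.
- exact: measurableT_comp.
- exact: measurableT_comp.
- by apply: filterS fg => w ? _.
Qed.

Context (P : probability E R).

Lemma probability1_ae (D : set E) : measurable D -> P D = 1 ->
  {ae P, forall w, D w}.
Proof.
move=> mD PD; apply/negligibleP; first exact: measurableC.
by have := probability_setC P mD; rewrite PD subee.
Qed.

(** Where [|I| >= K + e] and [|X| <= K], also [|X - I| >= e], an event whose probability can be made
    arbitrarily small. Hence [|I| < K + e] a.e. for each [e], and a countable sequence of [e]
    tending to 0 suffices. *)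
Lemma limit_in_prob_ae_le (I : E -> \bar R) (K : E -> R) :
  measurable_fun [set: E] I -> measurable_fun [set: E] K ->
  (forall eps eta : R, (0 < eps)%R -> (0 < eta)%R ->
    exists X : E -> \bar R, [/\ measurable_fun [set: E] X,
      {ae P, forall w, `|X w| <= (K w)%:E} &
      P [set w | eps%:E <= `|X w - I w|] < eta%:E]) ->
  {ae P, forall w, `|I w| <= (K w)%:E}.
Proof.
move=> mI mK hX.
have mabs (Y : E -> \bar R) : measurable_fun [set: E] Y ->
    measurable_fun [set: E] (fun w => `|Y w|) by exact: measurableT_comp.
have bound (e : R) : (0 < e)%R ->
    {ae P, forall w, ~ ((K w + e)%:E <= `|I w|)}.
  move=> e0; pose N := [set w | (K w + e)%:E <= `|I w|].
  have mN : measurable N.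
    rewrite -[N]setTI; apply: measurable_lee => //; last exact: mabs.
    by apply/measurable_EFinP; exact: measurable_funD.
  apply/negligibleP; first by rewrite setCK.
  rewrite (_ : [set _ | ~ _] = ~` N)// setCK.
  apply/eqP; rewrite eq_le measure_ge0 andbT; apply/lee_addgt0Pr => eta eta0.
  rewrite add0e.
  have [X [mX XK Xe]] := hX e eta e0 eta0.
  set D := [set w | _] in Xe.
  have mD : measurable D.
    rewrite -[D]setTI; apply: emeasurable_fun_c_infty => //.
    by apply: mabs; exact: emeasurable_funB.
  (* Off the null set [Z] the bound on [X] holds, so [N] is contained in the union of [D] and
     [Z]. *)
  have [Z [mZ PZ XZ]] := XK.
  apply: le_trans (ltW Xe); rewrite -(measureU0 mD mZ PZ).
  apply: le_measure; rewrite ?inE//; first exact: measurableU.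
  move=> w Nw; have [Zw|Zw] := pselect (Z w); [by right | left].
  have {Zw} : `|X w| <= (K w)%:E.
    by apply: contrapT => h; apply: Zw; exact: XZ.
  move: Nw; rewrite /N /D /=.
  (* [X w] is finite by its bound; an infinite [I w] makes the distance [+oo], and a finite one
     leaves the reverse triangle inequality. *)
  case: (X w) => [x| |]//; case: (I w) => [i| |]//=; rewrite ?lee_fin ?leey//.
  move=> Ki xK; have := lerB_dist i x; rewrite distrC; lra.
have n0 (n : nat) : (0 < n.+1%:R^-1 :> R)%R by rewrite invr_gt0.
have /ae_foralln := fun n => bound _ (n0 n).
apply: filterS => w h; apply/lee_addgt0Pr => e e0.
have [n ne] : exists n : nat, (n.+1%:R^-1 < e)%R.
  have [n _ hn] := near_infty_natSinv_lt (PosNum e0).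
  by exists n; exact: hn (leqnn n).
have /negP := h n; rewrite -ltNge EFinD => /ltW /le_trans; apply.
by rewrite leeD2l// lee_fin ltW.
Qed.

(** The integrand [|X - I|] is below [eps] off the exceptional event and at most [2 K] a.e. on
    it. *)
Lemma dist_integral_le (X I : E -> \bar R) (K : E -> R) (eps : R) :
  measurable_fun [set: E] X -> measurable_fun [set: E] I ->
  P.-integrable [set: E] (EFin \o K) -> (forall w, 0 <= K w)%R ->
  {ae P, forall w, `|X w| <= (K w)%:E} ->
  {ae P, forall w, `|I w| <= (K w)%:E} -> (0 <= eps)%R ->
  `|\int[P]_w X w - \int[P]_w I w| <=
    eps%:E + 2%:E * \int[P]_(w in [set w | eps%:E <= `|X w - I w|]) (K w)%:E.
Proof.
move=> mX mI iK K0 XK IK e0; set D := [set w | _].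
have mD : measurable D.
  rewrite -[D]setTI; apply: emeasurable_fun_c_infty => //.
  by apply: measurableT_comp => //; exact: emeasurable_funB.
have mK : measurable_fun [set: E] (EFin \o K) by exact: measurable_int iK.
have iX : P.-integrable [set: E] X.
  by apply: ae_le_integrable iK => //; apply: filterS XK => w;
    rewrite /= (ger0_norm (K0 w)).
have iI : P.-integrable [set: E] I.
  by apply: ae_le_integrable iK => //; apply: filterS IK => w;
    rewrite /= (ger0_norm (K0 w)).
have mKD : measurable_fun [set: E] ((EFin \o K) \_ D).
  by apply/(measurable_restrictT _ mD); exact: measurable_funS mK.
have KD0 w : 0 <= ((EFin \o K) \_ D) w.
  by rewrite patchE; case: ifP => //= _; rewrite lee_fin.
rewrite -integralB// (le_trans (le_abse_integral _ _ _))//.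
  exact: emeasurable_funB.
rewrite [X in _ * X]integral_mkcond -ge0_integralZl_EFin//.
(* Total mass 1 turns [eps] into an integral, so that only an a.e. comparison of integrands
   remains. *)
have -> : eps%:E = \int[P]_w (cst eps%:E) w.
  rewrite integral_cst// -[LHS]mule1; congr *%E.
  exact/esym/probability_setT.
rewrite -ge0_integralD//; [|by move=> w _; rewrite mule_ge0
  |exact: measurable_funeM].
apply: ae_ge0_le_integral => //.
- by apply: measurableT_comp => //; exact: emeasurable_funB.
- by move=> w _; rewrite adde_ge0 ?lee_fin// mule_ge0.
- by apply: emeasurable_funD => //; exact: measurable_funeM.
apply: filterS2 XK IK => w xK iK' _; rewrite patchE.
case: ifPn => [_|].
  rewrite (le_trans (lee_abs_sub _ _))//.
  rewrite (le_trans (leeD xK iK'))//= -EFinM -!EFinD lee_fin; lra.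
rewrite notin_setE /D /= mule0 adde0 => /negP; rewrite -ltNge; exact: ltW.
Qed.

End domination.

(** * Riemann sums of a dominated family *)

Section riemann_sum.
Context d (E : measurableType d) (R : realType) (P : probability E R).
Context (a b : R) (f : R -> E -> \bar R) (g : E -> R).
Hypothesis mf : forall t, a <= t <= b -> measurable_fun [set: E] (f t).
Hypothesis ig : P.-integrable [set: E] (EFin \o g).
Hypothesis g0 : forall w, 0 <= g w.
Hypothesis fg : forall t, a <= t <= b ->
  {ae P, forall w, (`|f t w| <= (g w)%:E)%E}.

Lemma dominated_integrable t : a <= t <= b -> P.-integrable [set: E] (f t).
Proof.
move=> tab; apply: ae_le_integrable ig; first exact: mf.
by apply: filterS (fg tab) => w /=; rewrite (ger0_norm (g0 w)).
Qed.

Section division.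
Context (delta : R -> R) (s : seq R) (xi : nat -> R).
Hypothesis sxi : fine_tagged_division a b delta s xi.

(** Ordinal indices carry the bound [i < size s], which places the tag [xi i] in [a, b]. *)
Let rv_riemann_sumE w : rv_riemann_sum a b f s xi w =
  (\sum_(i < size s)
     f (xi i) w * (div_pt a b s i.+1 - div_pt a b s i)%:E)%E.
Proof. by rewrite /rv_riemann_sum big_mkord. Qed.

Let integrable_term (i : 'I_(size s)) : P.-integrable [set: E]
  (fun w => f (xi i) w * (div_pt a b s i.+1 - div_pt a b s i)%:E)%E.
Proof.
apply: integrableZr => //.
exact/dominated_integrable/(fine_tag_itv sxi).
Qed.

Lemma integrable_rv_riemann_sum :
  P.-integrable [set: E] (rv_riemann_sum a b f s xi).
Proof.
rewrite (_ : rv_riemann_sum a b f s xi = (fun w => \sum_(i < size s)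
     f (xi i) w * (div_pt a b s i.+1 - div_pt a b s i)%:E)%E); last first.
  exact/funext/rv_riemann_sumE.
by apply: integrable_sum.
Qed.

Lemma integral_rv_riemann_sum :
  (\int[P]_w rv_riemann_sum a b f s xi w =
   (riemann_sum a b (fun t => fine (\int[P]_w f t w)) s xi)%:E)%E.
Proof.
under eq_integral do rewrite rv_riemann_sumE.
rewrite integral_sum// /riemann_sum big_mkord -sumEFin.
apply: eq_bigr => i _.
have ii : P.-integrable [set: E] (f (xi i)).
  exact/dominated_integrable/(fine_tag_itv sxi).
by rewrite integralZr// EFinM fineK// integrable_fin_num.
Qed.

Lemma rv_riemann_sum_ae_le :
  {ae P, forall w, (`|rv_riemann_sum a b f s xi w| <= ((b - a) * g w)%:E)%E}.
Proof.
(* The null set in [fg] depends on the tag, but there are only countably many tags. The guard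
   [i < size s] is needed because later values of [xi] may leave [a, b]. *)
have := @ae_foralln _ _ _ P
  (fun i w => (i < size s)%N -> (`|f (xi i) w| <= (g w)%:E)%E).
have tg i : {ae P, forall w,
    (i < size s)%N -> (`|f (xi i) w| <= (g w)%:E)%E}.
  have [is_|is_] := boolP (i < size s)%N; last exact: aeW.
  by apply: filterS (fg (fine_tag_itv sxi is_)).
move=> /(_ tg); apply: filterS => w h; rewrite rv_riemann_sumE.
rewrite (le_trans (lee_abs_sum _ _ _))//.
rewrite -(sum_div_pt sxi.1) big_mkord mulr_suml -sumEFin.
apply: lee_sum => i _.
have di : 0 <= div_pt a b s i.+1 - div_pt a b s i.
  by rewrite subr_ge0 (div_pt_le sxi.1).
rewrite abseM [X in (_ * X)%E]gee0_abs ?lee_fin// muleC EFinM.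
by rewrite lee_wpmul2l ?lee_fin// h.
Qed.

End division.

(** * Integrability and expectation of the integral in probability *)

Section integral_in_prob.
Context (I : E -> \bar R).
Hypothesis hI : is_KH_integral_in_prob P a b f I.
Hypothesis ab : a <= b.

Lemma KH_integral_in_prob_ae_le :
  {ae P, forall w, (`|I w| <= ((b - a) * g w)%:E)%E}.
Proof.
have mg : measurable_fun [set: E] g by apply/measurable_EFinP/measurable_int/ig.
apply: limit_in_prob_ae_le; first exact: hI.1.1.
  exact: measurable_funM.
move=> eps eta e0 eta0; have [delta [gd hd]] := hI.2 _ _ e0 eta0.
have [s [xi sxi]] := fine_tagged_division_exists ab gd.
exists (rv_riemann_sum a b f s xi); split.
- exact: measurable_int (integrable_rv_riemann_sum sxi).
- exact: rv_riemann_sum_ae_le sxi.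
- exact: hd sxi.
Qed.

Let iK : P.-integrable [set: E] (EFin \o (fun w => (b - a) * g w)).
Proof.
rewrite (_ : _ \o _ = fun w => (b - a)%:E * (EFin \o g) w)%E.
  exact: integrableZl.
by apply/funext => w /=; rewrite EFinM.
Qed.

Let K0 w : 0 <= (b - a) * g w. Proof. by rewrite mulr_ge0// subr_ge0. Qed.

Lemma integrable_KH_integral_in_prob : P.-integrable [set: E] I.
Proof.
apply: ae_le_integrable iK; first exact: hI.1.1.
by apply: filterS KH_integral_in_prob_ae_le => w /=; rewrite (ger0_norm (K0 w)).
Qed.

Lemma is_KH_integral_expectation :
  is_KH_integral a b (fun t => fine (\int[P]_w f t w))
    (fine (\int[P]_w I w)).
Proof.
move=> e e0.
have e2 : 0 < e / 2 by rewrite divr_gt0.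
have e4 : 0 < e / 4 by rewrite divr_gt0.
(* Absolute continuity: events of probability below [eta] carry less than [e / 4] of the integral of
   [(b - a) g], so the final bound is below [e / 2 + 2 (e / 4) = e]. *)
have [eta [eta0 heta]] := integral_normr_continuous iK e4.
have [delta [gd hd]] := hI.2 _ _ e2 eta0.
exists delta; split=> // s xi sxi.
set D := [set w | ((e / 2)%:E <=
  `|rv_riemann_sum a b f s xi w - I w|)%E].
have iS := integrable_rv_riemann_sum sxi.
have mS := measurable_int _ iS.
have mD : measurable D.
  rewrite -[D]setTI; apply: emeasurable_fun_c_infty => //.
  apply: measurableT_comp => //; apply: emeasurable_funB => //.
  exact: hI.1.1.
have := dist_integral_le mS hI.1.1 iK K0 (rv_riemann_sum_ae_le sxi)
  KH_integral_in_prob_ae_le (ltW e2).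
have iKD : P.-integrable D (EFin \o (fun w => (b - a) * g w)).
  exact: integrableS iK.
rewrite -/D (integral_rv_riemann_sum sxi).
rewrite -[X in (_ - X)%E]fineK; last first.
  exact: integrable_fin_num integrable_KH_integral_in_prob.
rewrite -[X in (_ * X)%E]fineK; last exact: integrable_fin_num.
rewrite -EFinM -EFinD lee_fin distrC => /le_lt_trans; apply.
have := heta D mD (hd _ _ sxi); rewrite /Rintegral.
under eq_integral do rewrite ger0_norm//.
lra.
Qed.

End integral_in_prob.
End riemann_sum.

Theorem theorem3p3 (d : measure_display) (E : measurableType d) (R : realType)
  (P : probability E R) (a b : R) (hab : a < b)
  (f : R -> E -> \bar R)
  (hfL : forall t : R, a <= t <= b -> ae_finite_rv P (f t))
  (hf : KH_integrable_in_prob P a b f)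
  (A : E -> \bar R)
  (hAL : ae_finite_rv P A)
  (hA1 : P.-integrable [set: E] A)
  (hA0 : {ae P, forall w : E, (0 <= A w)%E})
  (hfA : forall t : R, a <= t <= b ->
     P [set w : E | (`|f t w| <= A w)%E] = 1%E) :
  [/\ forall t : R, a <= t <= b -> P.-integrable [set: E] (f t),
      KH_integrable a b (fun t : R => fine (\int[P]_w f t w)) &
      forall (I : E -> \bar R) (J : R),
        is_KH_integral_in_prob P a b f I ->
        is_KH_integral a b (fun t : R => fine (\int[P]_w f t w)) J ->
        P.-integrable [set: E] I /\ J%:E = (\int[P]_w I w)%E].
Proof.
have mA := hAL.1.
have mf t : a <= t <= b -> measurable_fun [set: E] (f t) by move=> /hfL[].
(* [g] agrees a.e. with [A], but is real-valued and nonnegative everywhere. *)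
pose g w := `|fine (A w)|.
have mg : measurable_fun [set: E] g.
  by apply: measurableT_comp => //; exact: measurableT_comp.
have ig : P.-integrable [set: E] (EFin \o g).
  apply: le_integrable hA1 => //; first exact/measurable_EFinP.
  (* [fine] sends infinite values to 0, so [g <= |A|] holds everywhere. *)
  by move=> w _ /=; rewrite /g; case: (A w) => [r| |]//=;
    rewrite ?normr_id ?normr0 ?leey.
have g0 w : 0 <= g w by exact: normr_ge0.
have fg t : a <= t <= b -> {ae P, forall w, (`|f t w| <= (g w)%:E)%E}.
  move=> tab.
  have fA : {ae P, forall w, (`|f t w| <= A w)%E}.
    apply: probability1_ae (hfA t tab).
    rewrite -[X in measurable X]setTI; apply: measurable_lee => //.
    by apply: measurableT_comp => //; exact: mf.
  apply: filterS2 hAL.2 fA => w Afin /le_trans; apply.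
  by rewrite -[leLHS]fineK// lee_fin ler_norm.
have KH := is_KH_integral_expectation mf ig g0 fg.
split; first by move=> t; exact: (dominated_integrable mf ig g0 fg).
  by have [I hI] := hf; exists (fine (\int[P]_w I w)); exact: KH hI (ltW hab).
move=> I J hI hJ.
have iI := integrable_KH_integral_in_prob mf ig g0 fg hI (ltW hab).
(* The expectation of this particular [I] is also an integral of the same function, hence equals
   [J]. *)
split=> //; rewrite (is_KH_integral_unique (ltW hab) hJ (KH I hI (ltW hab))).
by rewrite fineK// integrable_fin_num.
Qed.
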